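(* For any $n,m,k\in\mathbb{Z}$ such that $k\geq (m-n)^+$, $$\underline{\nu}^n\left(\left\{\underline z: N^{\leftarrow p}_{m+\frac12}(\underline{z})=k\right\}\right)=\frac{q^{k(n-m+k)}\,(q;q)_\infty}{(q;q)_k\,(q;q)_{n-m+k}}.$$
   Context: Fix $q\in(0,1)$. $(x)^+=\max\{x,0\}$. For $a\in\mathbb{R}$, $(a;q)_0=1$, $(a;q)_n=\prod_{i=0}^{n-1}(1-aq^i)$ for $n\ge1$, and $(a;q)_\infty=\prod_{i=0}^\infty(1-aq^i)$. For $c\in\mathbb{R}$, the blocking measure $\underline{\mu}^c$ of the asymmetric simple exclusion process (ASEP) is the product probability measure on $\{0,1\}^{\mathbb{Z}}$ under which the coordinates $z_i$ are independent with $\underline\mu^c(z_i=1)=\frac{q^{c-i}}{1+q^{c-i}}$. Let $N(\underline z)=\sum_{i=1}^\infty(1-z_i)-\sum_{i=-\infty}^0 z_i$, which is finite $\underline\mu^c$-a.s. For $n\in\mathbb{Z}$, the ergodic blocking measure is $\underline\nu^n(\cdot)=\underline\mu^c(\,\cdot\mid N=n)$; it does not depend on $c$. For $m\in\mathbb{Z}$, $N^{\leftarrow p}_{m+\frac12}(\underline z)=\sum_{i=-\infty}^m z_i$ is the number of particles at and to the left of site $m$. *)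

(* Defs.v *)
From HB Require Import structures.
From mathcomp Require Import all_boot all_order all_algebra.
From mathcomp Require Import all_classical all_reals all_analysis.

Set Implicit Arguments.
Unset Strict Implicit.
Unset Printing Implicit Defensive.

Import Order.TTheory GRing.Theory Num.Theory.
Import numFieldNormedType.Exports.

Local Open Scope classical_set_scope.
Local Open Scope ring_scope.

Definition qpoch (R : realType) (a q : R) (n : nat) : R :=
  \prod_(i < n) (1 - a * q ^+ i).

Definition qpoch_inf (R : realType) (a q : R) : R := limn (qpoch a q).

Definition cylinders : set (set (int -> bool)) :=
  [set C | exists (i : int) (B : set bool), C = [set z | B (z i)]].

(* {0,1}^Z with the product sigma-algebra. *)
Definition config := g_sigma_algebraType cylinders.

Definition mutually_independent d d' (R : realType) (T : measurableType d)
    (T' : measurableType d') (I : eqType) (P : probability T R)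
    (X : I -> T -> T') : Prop :=
  forall (s : seq I) (B : I -> set T'), uniq s ->
    (forall i, measurable (B i)) ->
    P (\bigcap_(i in [set` s]) (X i @^-1` B i)) =
    (\prod_(i <- s) P (X i @^-1` B i))%E.

(* These two properties determine the measure mu uniquely. *)
Definition is_blocking_measure (R : realType) (q c : R)
    (mu : probability config R) : Prop :=
  mutually_independent mu (fun (i : int) (z : config) => z i) /\
  (forall i : int, mu [set z : config | z i = true] =
     (q `^ (c - i%:~R) / (1 + q `^ (c - i%:~R)))%:E).

(* In extended reals +oo - +oo = -oo, so Nfun takes an integer value exactly
   when both of its sums are finite. *)
Definition Nfun (R : realType) (z : config) : \bar R :=
  (\sum_(0 <= j <oo) (1 - (z (j.+1)%:Z)%:R)%R%:E
   - \sum_(0 <= j <oo) ((z (- j%:Z))%:R)%:E)%E.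

Definition Nleft (R : realType) (m : int) (z : config) : \bar R :=
  (\sum_(0 <= j <oo) ((z (m - j%:Z))%:R)%:E)%E.

Definition cond_prob d (R : realType) (T : measurableType d)
    (P : probability T R) (A B : set T) : R :=
  fine (P (A `&` B)) / fine (P B).

Definition ergodic_blocking (R : realType) (mu : probability config R)
    (n : int) (A : set config) : R :=
  cond_prob mu A [set z | Nfun R z = (n%:~R)%:E].

(* Main.v *)
Require Import Defs.
From mathcomp Require Import all_boot all_order all_algebra.
From mathcomp Require Import all_classical all_reals all_analysis.
From mathcomp Require Import zify ring.

Import Order.TTheory GRing.Theory Num.Theory.
Import numFieldNormedType.Exports.

Local Open Scope classical_set_scope.
Local Open Scope ring_scope.

(* Let x_i = q^(c-i). In the window (-M, M] the event {N^<-_{m+1/2} = k, N = n}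
   asks for k particles on (-M, m] and M - n - k particles on (m, M]. The weights
   are geometric, so by the finite q-binomial theorem its probability is
   K_M(n) q^(kh) [M+m, k]_q [M-m, h]_q with h = n - m + k, where the prefactor
   K_M(n) does not depend on m and k. The indicators converge pointwise as M
   tends to infinity, hence
     mu(N^<-_{m+1/2} = k, N = n) = K(n) q^(kh) / ((q)_k (q)_h).
   Taking k = 0 and letting m tend to minus infinity gives
   mu(N = n) = K(n) / (q)_oo, which replaces the Durfee rectangle identity.
   The quotient is the claim, and K(n) > 0 since the products
   prod_i (1 + b q^i) are bounded by exp(b / (1 - q)). *)

(** * Finite q-binomial theorem *)

(** The window [(a - r, a]], listed from right to left: for weights with [x (i - 1) = x i * q],
    those along the list are [x a], [x a * q], [x a * q ^+ 2], and so on. *)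
Definition sites (a : int) (r : nat) : seq int :=
  [seq a - j%:Z | j <- iota 0 r].

Lemma sitesS (a : int) (r : nat) : sites a r.+1 = a :: sites (a - 1) r.
Proof.
rewrite /sites /= subr0 -[1%N]addn0 iotaDl -map_comp.
by congr (_ :: _); apply: eq_map => j /=; lia.
Qed.

Lemma sites_cat (a : int) (r s : nat) :
  sites a (r + s) = sites a r ++ sites (a - r%:Z) s.
Proof.
elim: r a => [|r IHr] a; first by rewrite subr0.
rewrite addSn !sitesS IHr /=; congr (_ :: (_ ++ _)).
by congr sites; lia.
Qed.

Lemma size_sites (a : int) (r : nat) : size (sites a r) = r.
Proof. by rewrite size_map size_iota. Qed.

Lemma uniq_sites (a : int) (r : nat) : uniq (sites a r).
Proof. by rewrite map_inj_uniq ?iota_uniq // => i j; lia. Qed.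

(** The elementary symmetric polynomial of degree [k] in the weights of [s], that is, the
    unnormalised probability of [k] particles in [s]. *)
Fixpoint esym (R : nzRingType) (x : int -> R) (s : seq int) (k : nat) : R :=
  match s, k with
  | i :: s', k'.+1 => esym R x s' k'.+1 + x i * esym R x s' k'
  | _, 0 => 1
  | [::], _ => 0
  end.
Arguments esym {R}.

Lemma esym0 (R : nzRingType) (x : int -> R) (s : seq int) : esym x s 0 = 1.
Proof. by case: s. Qed.

Lemma esym_oversize (R : nzRingType) (x : int -> R) (s : seq int) (k : nat) :
  (size s < k)%N -> esym x s k = 0.
Proof.
elim: s k => [|i s IHs] [|k] //= lt_sk.
by rewrite !IHs ?mulr0 ?addr0 // ltnW.
Qed.

Lemma qpochS (R : realType) (a q : R) (n : nat) :
  qpoch a q n.+1 = qpoch a q n * (1 - a * q ^+ n).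
Proof. by rewrite /qpoch big_ord_recr. Qed.

Lemma qpoch0 (R : realType) (a q : R) : qpoch a q 0 = 1.
Proof. by rewrite /qpoch big_ord0. Qed.

(* The finite q-binomial theorem, with the q-binomial coefficient
   [(q)_(k+j) / ((q)_k (q)_j)] cleared of denominators. *)
Lemma esym_sites (R : realType) (q : R) (x : int -> R) (a : int) (k j : nat) :
  (forall i, x (i - 1) = x i * q) ->
  esym x (sites a (k + j)) k * (qpoch q q k * qpoch q q j) =
  x a ^+ k * q ^+ 'C(k, 2) * qpoch q q (k + j).
Proof.
(* The recursion of [esym] leads from [(k + 1, j)] to [(k, j)] and [(k + 1, j - 1)], so the
   induction runs on a bound for [k + j]. *)
move=> xB1; have [r] := ubnP (k + j).
elim: r => // r IHr in a k j * => /ltnSE le_kj_r.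
case: k => [|k] in le_kj_r *.
  by rewrite esym0 !expr0 qpoch0 !mul1r.
rewrite addSn sitesS /=.
have IHk : esym x (sites (a - 1) (k + j)) k * (qpoch q q k * qpoch q q j) =
    (x a * q) ^+ k * q ^+ 'C(k, 2) * qpoch q q (k + j).
  by rewrite -xB1; apply: IHr; lia.
have -> : 'C(k.+1, 2) = (k + 'C(k, 2))%N by rewrite binS bin1 addnC.
rewrite mulrDl exprD !qpochS.
case: j => [|j] in le_kj_r IHk *.
  move: IHk; rewrite !addn0 qpoch0 [esym _ _ k.+1]esym_oversize ?size_sites //.
  set e := esym _ _ _ => IHk; rewrite mul0r add0r.
  transitivity (x a * (1 - q * q ^+ k) * (e * (qpoch q q k * 1))); first by ring.
  by rewrite IHk exprMn exprS; ring.
have := IHr (a - 1) k.+1 j; rewrite xB1 addSnnS !qpochS.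
have -> : 'C(k.+1, 2) = (k + 'C(k, 2))%N by rewrite binS bin1 addnC.
rewrite exprD => /(_ ltac:(lia)); move: IHk; rewrite !addnS !qpochS.
set e := esym _ _ k; set e' := esym _ _ k.+1 => IHk IHj.
(* The q-Pascal rule: q^(k+1) (1 - q^(j+1)) + (1 - q^(k+1)) = 1 - q^(k+j+2). *)
transitivity ((1 - q * q ^+ j) *
   (e' * (qpoch q q k * (1 - q * q ^+ k) * qpoch q q j)) +
   x a * (1 - q * q ^+ k) *
   (e * (qpoch q q k * (qpoch q q j * (1 - q * q ^+ j))))); first by ring.
by rewrite IHk IHj !exprMn !exprS exprD; ring.
Qed.

(** * Limits *)

Lemma qpochN_le (R : realType) (b q : R) (n : nat) :
  0 <= b -> 0 < q < 1 -> qpoch (- b) q n <= expR (b / (1 - q)).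
Proof.
move=> b0 /andP[q0 q1].
have q1' : 0 < 1 - q by rewrite subr_gt0.
have sum_le : b * \sum_(i < n) q ^+ i <= b / (1 - q).
  apply: ler_wpM2l => //; rewrite -[_^-1]mul1r ler_pdivlMr// mulrC.
  rewrite -opprB mulNr -subrX1 opprB gerBl.
  by rewrite exprn_ge0 // ltW.
apply: (@le_trans _ _ (expR (b * \sum_(i < n) q ^+ i))); last by rewrite ler_expR.
rewrite mulr_sumr expR_sum; apply: ler_prod => i _.
rewrite mulNr opprK expR_ge1Dx andbT addr_ge0 //.
by rewrite mulr_ge0 // exprn_ge0 // ltW.
Qed.

Lemma qpoch_gt0 (R : realType) (q : R) (n : nat) :
  0 < q < 1 -> 0 < qpoch q q n.
Proof.
move=> /andP[q0 q1]; apply: prodr_gt0 => i _.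
by rewrite subr_gt0 -exprS exprn_ilt1 // ltW.
Qed.

(** The bound is uniform in [n], so the infinite product is positive. From 1 / (1 - q^(i+1)) <= 1 +
    b q^i with b = q / (1 - q), the inverse of [qpoch q q n] is at most [qpoch (- b) q n]. *)
Lemma qpochqq_ge (R : realType) (q : R) (n : nat) :
  0 < q < 1 -> expR (- (q / (1 - q) / (1 - q))) <= qpoch q q n.
Proof.
move=> /andP[q0 q1]; have q01 : 0 < q < 1 by rewrite q0.
have q1' : 0 < 1 - q by rewrite subr_gt0.
set b := q / (1 - q); have b0 : 0 <= b by rewrite divr_ge0 // ltW.
have le1 : 1 <= qpoch q q n * qpoch (- b) q n.
  rewrite -big_split /=; elim/big_ind: _ => // [x y x1 y1|i _].
    exact: mulr_ege1.
  have -> : (1 - q * q ^+ i) * (1 - - b * q ^+ i) =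
      1 + q ^+ 2 * q ^+ i * (1 - q ^+ i) / (1 - q).
    by rewrite /b; field; apply: lt0r_neq0.
  rewrite lerDl divr_ge0 ?(ltW q1') // mulr_ge0 //.
    by rewrite mulr_ge0 // exprn_ge0 // ltW.
  by rewrite subr_ge0 exprn_ile1 // ltW.
rewrite expRN -[_^-1]mul1r ler_pdivrMr ?expR_gt0 //.
apply: le_trans le1 _; apply: ler_wpM2l; last exact: qpochN_le.
by rewrite ltW // qpoch_gt0.
Qed.

Lemma cvg_qpochqq (R : realType) (q : R) :
  0 < q < 1 -> qpoch q q n @[n --> \oo] --> qpoch_inf q q.
Proof.
move=> q01; apply: (@nonincreasing_is_cvgn R).
  apply/nonincreasing_seqP => n; rewrite qpochS ger_pMr ?qpoch_gt0 //.
  by case/andP: q01 => q0 q1; rewrite gerBl -exprS exprn_ge0 // ltW.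
exists (expR (- (q / (1 - q) / (1 - q)))) => _ [n _ <-].
exact: qpochqq_ge.
Qed.

Lemma qpoch_inf_gt0 (R : realType) (q : R) : 0 < q < 1 -> 0 < qpoch_inf q q.
Proof.
move=> q01; apply: lt_le_trans (expR_gt0 (- (q / (1 - q) / (1 - q)))) _.
apply: limr_ge; first by apply: cvgP; exact: cvg_qpochqq.
by near=> n; exact: qpochqq_ge.
Unshelve. all: by end_near. Qed.

(** * Continuity of probability for pointwise convergent indicators *)

Section eventually_equal_sets.
Context d (T : measurableType d) (R : realType) (P : probability T R).
Context (F : nat -> set T) (E : set T).
Hypothesis mF : forall n, measurable (F n).
Hypothesis FE : forall z, \forall n \near \oo, F n z <-> E z.

Let G n := \bigcap_(i in [set i | (n <= i)%N]) F i.
Let H n := \bigcup_(i in [set i | (n <= i)%N]) F i.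

Let bigcupG : \bigcup_n G n = E.
Proof.
apply/seteqP; split => z; case: (FE z) => n0 _ FEz.
  case=> n _ Gz; apply: (FEz (maxn n n0) (leq_maxr _ _)).1.
  by apply: Gz; exact: leq_maxl.
by move=> Ez; exists n0 => // i /= ni; exact: (FEz i ni).2.
Qed.

Let bigcapH : \bigcap_n H n = E.
Proof.
apply/seteqP; split => z; case: (FE z) => n0 _ FEz.
  by case/(_ n0 Logic.I) => i ni; exact: (FEz i ni).1.
move=> Ez n _; exists (maxn n n0); first exact: leq_maxl.
exact: (FEz (maxn n n0) (leq_maxr _ _)).2.
Qed.

Let mG n : measurable (G n).
Proof. by apply: bigcap_measurable => //; exists n => /=. Qed.

Let mH n : measurable (H n).
Proof. by apply: bigcup_measurable => i _; exact: mF. Qed.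

Lemma measurable_eventually : measurable E.
Proof. by rewrite -bigcupG; exact: bigcupT_measurable. Qed.

(** [F n] lies between the tail intersection [G n], which increases to [E], and the tail union
    [H n], which decreases to [E]; continuity from below and from above squeezes its probability. *)
Lemma cvg_probability_eventually :
  fine (P (F n)) @[n --> \oo] --> fine (P E).
Proof.
apply: fine_cvg; rewrite fineK ?fin_num_measure//; last exact: measurable_eventually.
apply: (@squeeze_cvge _ _ _ _ (P \o G) _ (P \o H)).
- near=> n; apply/andP; split; apply: le_measure; rewrite ?inE //.
  + by move=> z; apply => /=.
  + by move=> z Fz; exists n => /=.
- rewrite -bigcupG; apply: nondecreasing_cvg_mu => //.
    by rewrite bigcupG; exact: measurable_eventually.
  apply/nondecreasing_seqP => n; rewrite subsetEset => z Gz i /= ni.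
  by apply: Gz => /=; exact: ltnW.
- rewrite -bigcapH; apply: nonincreasing_cvg_mu => //.
  + by rewrite (le_lt_trans (probability_le1 _ _)) // ltry.
  + by rewrite bigcapH; exact: measurable_eventually.
  apply/nonincreasing_seqP => n; rewrite subsetEset => z [i /= ni Fz].
  by exists i => //=; exact: ltnW.
Unshelve. all: by end_near. Qed.

End eventually_equal_sets.

(** * Particle counts under a product measure *)

Lemma measurable_site (i : int) (B : set bool) :
  measurable [set z : config | B (z i)].
Proof. by apply: sub_sigma_algebra; exists i, B. Qed.

(** An arbitrary Boolean function [phi] lets the induction fix the value of the first site and
    absorb it into [phi]. *)
Lemma measurable_window (s : seq int) (phi : seq bool -> bool) :
  measurable [set z : config | phi (map z s)].
Proof.
elim: s phi => [|i s IHs] phi /=.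
  by case: (phi [::]); [rewrite set_true|rewrite set_false].
have -> : [set z : config | phi (z i :: map z s)] =
    [set z : config | [set true] (z i)] `&`
      [set z : config | phi (true :: map z s)] `|`
    [set z : config | [set false] (z i)] `&`
      [set z : config | phi (false :: map z s)].
  apply/seteqP; split => z /=.
    by case: (z i) => ?; [left|right].
  by case=> -[-> ?].
apply: measurableU; apply: measurableI; (exact: measurable_site ||
  exact: (IHs (fun w => phi (_ :: w)))).
Qed.

Definition agree (t : seq int) (b : int -> bool) : set config :=
  [set z | all (fun i => z i == b i) t].

Lemma measurable_agree (t : seq int) (b : int -> bool) :
  measurable (agree t b).
Proof.
have -> : agree t b = [set z : config | map z t == map b t].
  by apply/funext => z; rewrite /agree /= eq_map_all all_map.
exact: (measurable_window t (fun w => w == map b t)).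
Qed.

Definition count_eq (s : seq int) (k : nat) : set config :=
  [set z : config | count z s == k].

Lemma measurable_count (s : seq int) (k : nat) :
  measurable (count_eq s k).
Proof.
have -> : count_eq s k = [set z : config | count id (map z s) == k].
  by apply/seteqP; split => z; rewrite /count_eq /= count_map.
exact: (measurable_window s (fun w => count id w == k)).
Qed.

Lemma count_eq_cons (i : int) (s : seq int) (k : nat) (v : bool) :
  count_eq (i :: s) (v + k) `&` [set z | z i = v] =
  count_eq s k `&` [set z | z i = v].
Proof.
by apply/seteqP; split => z; rewrite /count_eq /= => -[+ zi];
  rewrite zi eqn_add2l.
Qed.

Section product_measure.
Context (R : realType) (mu : probability config R) (x : int -> R).
Hypothesis x_gt0 : forall i, 0 < x i.
Hypothesis indep : mutually_independent mu (fun (i : int) (z : config) => z i).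
Hypothesis density :
  forall i, mu [set z : config | z i = true] = (x i / (1 + x i))%:E.

Let Pr (A : set config) : R := fine (mu A).

Let PrE A : measurable A -> mu A = (Pr A)%:E.
Proof. by move=> mA; rewrite fineK ?fin_num_measure. Qed.

Definition site_prob (i : int) (b : bool) : R :=
  (if b then x i else 1) / (1 + x i).

Let x1_neq0 i : 1 + x i != 0.
Proof. by rewrite gt_eqF // addr_gt0. Qed.

Lemma prob_site (i : int) (b : bool) :
  mu [set z : config | z i = b] = (site_prob i b)%:E.
Proof.
case: b; first exact: density.
have -> : [set z : config | z i = false] = ~` [set z : config | z i = true].
  by apply/seteqP; split => z /=; case: (z i).
rewrite probability_setC; last exact: (measurable_site i [set true]).
by rewrite density -EFinB; congr EFin; rewrite /site_prob; field.
Qed.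

Lemma prob_agree (t : seq int) (b : int -> bool) : uniq t ->
  Pr (agree t b) = \prod_(i <- t) site_prob i (b i).
Proof.
move=> /(indep t (fun i => [set b i])) => /(_ (fun _ => I)).
rewrite (eq_bigr (fun i => (site_prob i (b i))%:E)) => [|i _]; last first.
  exact: prob_site.
rewrite prodEFin => prodE; apply: EFin_inj; rewrite -prodE -PrE.
  congr (mu _).
  apply/seteqP; split => z /=.
    by move=> /allP zb i /zb /eqP.
  by move=> zb; apply/allP => i /zb /= ->.
exact: measurable_agree.
Qed.

Lemma prob_split (i : int) (A : set config) : measurable A ->
  Pr A = Pr (A `&` [set z | z i = true]) + Pr (A `&` [set z | z i = false]).
Proof.
move=> mA; have m_ b : measurable [set z : config | z i = b].
  exact: (measurable_site i [set b]).
apply: EFin_inj; rewrite EFinD -!PrE //; [|exact: measurableI..].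
rewrite -measureU; [|exact: measurableI..|].
  congr (mu _); rewrite -setIUr setIidl // => z _ /=.
  by case: (z i); [left|right].
by apply/seteqP; split => z //= [[_ ->] []].
Qed.

(* The factor [agree t b] makes the induction on [s] work: splitting off a site
   of [s] moves it to [t]. *)
Lemma prob_count (G : set config) (u s t : seq int) (g : R) (b : int -> bool)
    (k : nat) :
  measurable G ->
  (forall t' b', uniq (t' ++ u) ->
     Pr (G `&` agree t' b') = g * \prod_(i <- t') site_prob i (b' i)) ->
  uniq (s ++ t ++ u) ->
  Pr (count_eq s k `&` G `&` agree t b) =
  esym x s k / \prod_(i <- s) (1 + x i) * g *
    \prod_(i <- t) site_prob i (b i).
Proof.
move=> mG HG; elim: s t b k => [|i s IHs] t b k.
  rewrite /= big_nil divr1; case: k => [|k] uniq_tu.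
    rewrite mul1r -HG //; congr (Pr (_ `&` _)).
    by apply/seteqP; split => z // [].
  rewrite !mul0r; transitivity (Pr set0); last by rewrite /Pr measure0.
  by congr Pr; apply/seteqP; split => z // [[]].
move=> uniq_istu.
have [i_notin uniq_stu] : i \notin s ++ t ++ u /\ uniq (s ++ t ++ u).
  by apply/andP; move: uniq_istu.
have i_notin_t : i \notin t.
  by move: i_notin; rewrite !mem_cat; case: (i \in t); rewrite // orbT.
have uniq_situ : uniq (s ++ (i :: t) ++ u).
  rewrite (perm_uniq (_ : perm_eq _ ((i :: s) ++ t ++ u))) //.
  by rewrite (perm_catCA s [:: i]).
have neq_i j : j \in t -> (j == i) = false.
  by move=> jt; apply: contraNF i_notin_t => /eqP <-.
(* The pattern that puts [v] at [i] and follows [b] on [t], which does not contain [i]. *)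
pose b_ v j := if j == i then v else b j.
have agree_i v : agree (i :: t) (b_ v) = agree t b `&` [set z | z i = v].
  apply/seteqP; split => z; rewrite /agree /= /b_ eqxx.
    move=> /andP[/eqP-> /allP zt]; split=> //; apply/allP => j jt.
    by have /= := zt j jt; rewrite neq_i.
  move=> [/allP zt ->]; rewrite eqxx; apply/allP => j jt /=.
  by rewrite neq_i //; exact: zt.
have prod_b v : \prod_(j <- i :: t) site_prob j (b_ v j) =
    site_prob i v * \prod_(j <- t) site_prob j (b j).
  rewrite big_cons /b_ eqxx; congr (_ * _); apply: eq_big_seq => j jt.
  by rewrite neq_i.
have term v k' : Pr (count_eq s k' `&` G `&` agree t b
      `&` [set z | z i = v]) =
    esym x s k' / \prod_(j <- s) (1 + x j) * g *
      (site_prob i v * \prod_(j <- t) site_prob j (b j)).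
  by rewrite -setIA -agree_i IHs // prod_b.
have mE : measurable (count_eq (i :: s) k `&` G `&` agree t b).
  apply: measurableI (measurable_agree _ _).
  exact: measurableI (measurable_count _ _) _.
rewrite (prob_split i) // big_cons; set S := \prod_(j <- s) _ in term *.
set E := _ `&` agree t b.
have falseE : E `&` [set z | z i = false] =
    count_eq s k `&` G `&` agree t b `&` [set z | z i = false].
  rewrite /E setIAC [_ `&` G `&` _]setIAC (count_eq_cons i s k false).
  by rewrite [_ `&` _ `&` G]setIAC setIAC.
have S_neq0 : S != 0 by rewrite prodf_seq_neq0; apply/allP => j _; exact: x1_neq0.
rewrite falseE term; case: k => [|k] in E mE falseE *.
  have -> : E `&` [set z | z i = true] = set0.
    by apply/seteqP; split => z // [[[+ Gz] zt] /= zi]; rewrite /count_eq /= zi.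
  rewrite !esym0 {1}/Pr measure0 /= /site_prob; field.
  by rewrite S_neq0 x1_neq0.
have -> : E `&` [set z | z i = true] =
    count_eq s k `&` G `&` agree t b `&` [set z | z i = true].
  rewrite /E setIAC [_ `&` G `&` _]setIAC (count_eq_cons i s k true).
  by rewrite [_ `&` _ `&` G]setIAC setIAC.
rewrite term /= /site_prob; field.
by rewrite S_neq0 x1_neq0.
Qed.

(** Two applications of [prob_count]: the first, with [G = setT], treats [s2] and shows that its
    count is independent of the sites outside [s2]; this is the hypothesis on [G] in the second,
    which treats [s1]. *)
Lemma prob_count2 (s1 s2 : seq int) (k1 k2 : nat) : uniq (s1 ++ s2) ->
  Pr (count_eq s1 k1 `&` count_eq s2 k2) =
  esym x s1 k1 * esym x s2 k2 / \prod_(i <- s1 ++ s2) (1 + x i).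
Proof.
move=> uniq_s.
have HT t' b' : uniq (t' ++ [::]) ->
    Pr (setT `&` agree t' b') = 1 * \prod_(i <- t') site_prob i (b' i).
  by rewrite cats0 setTI mul1r; exact: prob_agree.
have H2 t' b' : uniq (t' ++ s2) ->
    Pr (count_eq s2 k2 `&` agree t' b') =
    esym x s2 k2 / \prod_(i <- s2) (1 + x i) *
    \prod_(i <- t') site_prob i (b' i).
  rewrite uniq_catC => uniq_s2.
  rewrite -[_ / _]mulr1 -(prob_count _ _ _ _ _ _ _ measurableT HT) ?cats0 //.
  by rewrite setIT.
have := prob_count _ s2 s1 [::] _ (fun=> true) k1 (measurable_count _ _) H2 uniq_s.
rewrite big_nil mulr1.
have -> : agree [::] (fun=> true) = setT by apply/seteqP; split.
rewrite setIT => ->; rewrite big_cat /=; field.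
by rewrite !prodf_seq_neq0; apply/andP; split; apply/allP => j _; exact: x1_neq0.
Qed.

End product_measure.

(** * Window events *)

Lemma countSr (f : nat -> bool) (r : nat) :
  count f (iota 0 r.+1) = (count f (iota 0 r) + f r)%N.
Proof. by rewrite -addn1 iotaD count_cat /= addn0 add0n. Qed.

Lemma leq_count_iota (f : nat -> bool) (r s : nat) : (r <= s)%N ->
  (count f (iota 0 r) <= count f (iota 0 s))%N.
Proof. by move=> /subnKC <-; rewrite iotaD count_cat leq_addr. Qed.

(** A bounded nondecreasing sequence of naturals reaches its maximum and stays there. The dichotomy
    separates finite from infinite values of the series in [Nleft] and [Nfun]. *)
Lemma count_eventually (f : nat -> bool) :
  (exists a, \forall r \near \oo, count f (iota 0 r) = a) \/
  (forall a, \forall r \near \oo, (a < count f (iota 0 r))%N).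
Proof.
have [[B leB]|unb] := pselect (exists B, forall r, (count f (iota 0 r) <= B)%N).
  left; pose Q a := `[< exists r, count f (iota 0 r) = a >].
  have exQ : exists a, Q a by exists 0%N; apply/asboolP; exists 0%N.
  have ubQ a : Q a -> (a <= B)%N by move=> /asboolP[r <-].
  have [a /asboolP[r0 r0a] maxa] := ex_maxnP exQ ubQ.
  exists a, r0 => // r /= le_r0r; apply/eqP; rewrite eqn_leq maxa /=.
    by rewrite -r0a leq_count_iota.
  by apply/asboolP; exists r.
right=> a; have [r ltr] : exists r, (a < count f (iota 0 r))%N.
  apply: contrapT => /forallNP le_a; apply: unb; exists a => r.
  by rewrite leqNgt; apply/negP; exact: le_a.
by exists r => // s /= le_rs; apply: leq_trans ltr (leq_count_iota _ _ _ le_rs).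
Qed.

Lemma sum_count (R : realType) (f : nat -> bool) (r : nat) :
  (\sum_(0 <= j < r) ((f j)%:R : R)%:E)%E = ((count f (iota 0 r))%:R)%:E.
Proof.
rewrite sumEFin -sum1_count natr_sum [in RHS]big_mkcond /index_iota subn0 /=.
by congr EFin; apply: eq_bigr => j _; case: (f j).
Qed.

Lemma eseries_count (R : realType) (f : nat -> bool) (a : nat) :
  (\forall r \near \oo, count f (iota 0 r) = a) ->
  (\sum_(0 <= j <oo) ((f j)%:R : R)%:E)%E = (a%:R)%:E.
Proof.
move=> cnt_a; apply: cvg_lim => //; apply: cvg_near_cst.
case: cnt_a => r0 _ cnt_a; exists r0 => // r /cnt_a <-.
exact: sum_count.
Qed.

Lemma eseries_count_pinfty (R : realType) (f : nat -> bool) :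
  (forall a, \forall r \near \oo, (a < count f (iota 0 r))%N) ->
  (\sum_(0 <= j <oo) ((f j)%:R : R)%:E)%E = +oo%E.
Proof.
move=> cnt_gt; apply: cvg_lim => //; apply/cvgeyPge => A.
case: (cnt_gt (Num.bound `|A|)) => r0 _ {}cnt_gt; exists r0 => // r /cnt_gt ltr.
rewrite sum_count lee_fin; apply: le_trans (ler_norm _) _; apply: ltW.
apply: lt_le_trans (archi_boundP (normr_ge0 _)) _.
by rewrite ler_nat ltnW.
Qed.

Lemma near_absz_addr (m : int) (Q : nat -> Prop) :
  (\forall r \near \oo, Q r) -> \forall M \near \oo, Q (absz (M%:Z + m)%R).
Proof.
case=> r0 _ Qr; exists (r0 + absz m)%N => // M /= leM; apply: Qr => /=; lia.
Qed.

(** Trades the holes in [(0, M]], which [Nfun] counts, for particles, so that the truncated N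
    becomes a particle count of [(-M, M]]. *)
Lemma count_sites_opp (z : int -> bool) (M : nat) :
  (count z (sites M M) + count (fun j => ~~ z (j.+1)%:Z) (iota 0 M))%N = M.
Proof.
elim: M => // M IHM; rewrite countSr sitesS /=.
have -> : M.+1%:Z - 1 = M%:Z by lia.
case: (z M.+1); lia.
Qed.

(** The windows [(-M, 0]] and [(-M, m]] differ in [absz m] sites. Hence a finite [Nleft] makes the
    second sum of [Nfun] finite. *)
Lemma count_sites0_le (z : int -> bool) (m : int) (M : nat) : (absz m <= M)%N ->
  (count z (sites 0 M) <= count z (sites m (absz (M%:Z + m)%R)) + absz m)%N.
Proof.
move=> le_mM; have [m0|m0] := leP 0 m.
  have -> : (absz (M%:Z + m)%R) = (absz m + M)%N by lia.
  rewrite sites_cat (_ : m - (absz m)%:Z = 0); last lia.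
  by rewrite count_cat; lia.
have -> : sites 0 M = sites 0 (absz m + (absz (M%:Z + m)%R))%N by congr sites; lia.
rewrite sites_cat (_ : 0 - (absz m)%:Z = m); last lia.
rewrite count_cat addnC leq_add2l -{2}(size_sites 0 (absz m)); exact: count_size.
Qed.

(* The window (-M, M] contains M - n particles exactly when N, with both sums
   cut off at M, equals n. *)
Definition window (m n : int) (k M : nat) : set config :=
  count_eq (sites m (absz (M%:Z + m)%R)) k `&`
  [set z : config | (count z (sites M (M + M)))%:Z == M%:Z - n].

Lemma measurable_windowE (m n : int) (k M : nat) : measurable (window m n k M).
Proof.
apply: measurableI; first exact: measurable_count.
have -> : [set z : config | (count z (sites M (M + M)))%:Z == M%:Z - n] =
    [set z : config | (count id (map z (sites M (M + M))))%:Z == M%:Z - n].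
  by apply/funext => z; rewrite /= count_map.
exact: (measurable_window _ (fun w => (count id w)%:Z == M%:Z - n)).
Qed.

Lemma NleftE (R : realType) (m : int) (z : config) :
  Nleft R m z = (\sum_(0 <= j <oo) ((z (m - j%:Z))%:R : R)%:E)%E.
Proof. by []. Qed.

Lemma NfunE (R : realType) (z : config) :
  Nfun R z = (\sum_(0 <= j <oo) ((~~ z (j.+1)%:Z)%:R : R)%:E
    - \sum_(0 <= j <oo) ((z (0 - j%:Z))%:R : R)%:E)%E.
Proof.
rewrite /Nfun; congr (_ - _)%E; apply: eq_eseriesr => j _.
  by case: (z _); rewrite ?subrr ?subr0.
by rewrite sub0r.
Qed.

Lemma count_sites (z : int -> bool) (m : int) (r : nat) :
  count z (sites m r) = count (fun j : nat => z (m - j%:Z)) (iota 0 r).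
Proof. by rewrite count_map. Qed.

Definition level_set (R : realType) (m n : int) (k : nat) : set config :=
  [set z | Nleft R m z = (k%:R)%:E] `&` [set z | Nfun R z = (n%:~R)%:E].

(** This holds for every configuration, so no null set is removed: where a sum that matters is
    infinite, both sides are false for all large [M]. *)
Lemma window_eventually (R : realType) (m n : int) (k : nat) (z : config) :
  \forall M \near \oo, window m n k M z <-> level_set R m n k z.
Proof.
pose fL (j : nat) := z (m - j%:Z); pose f0 (j : nat) := z (0 - j%:Z).
pose fH (j : nat) := ~~ z (j.+1)%:Z.
have windowE M : window m n k M z <-> count fL (iota 0 (absz (M%:Z + m)%R)) = k /\
    (count f0 (iota 0 M))%:Z - (count fH (iota 0 M))%:Z = - n.
  rewrite /window /count_eq /setI /= -!count_sites sites_cat count_cat.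
  rewrite (_ : M%:Z - M%:Z = 0); last lia.
  have := count_sites_opp z M; rewrite -/fH.
  move: (count z (sites M M)) (count z (sites 0 M)) (count fH _) => p r h eqM.
  by split=> -[/eqP-> ?]; split=> //; lia.
rewrite /level_set /setI /= NleftE NfunE -/fH.
have [[a cntL]|cntL] := count_eventually fL; last first.
  rewrite (eseries_count_pinfty R fL cntL).
  have := near_absz_addr m _ (cntL k); apply: filterS => M ltM.
  split=> [w|[]//]; have [eqk _] := (windowE M).1 w.
  by rewrite eqk ltnn in ltM.
rewrite (eseries_count R fL a cntL).
have {}cntL := near_absz_addr m _ cntL.
have [eq_ak|neq_ak] := eqVneq a k; last first.
  apply: filterS cntL => M eqM; split=> [w|[[/eqP +] _]].
    by have [] := (windowE M).1 w; rewrite eqM => /eqP; rewrite (negPf neq_ak).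
  by rewrite eqr_nat (negPf neq_ak).
rewrite {}eq_ak in cntL *.
have [[b cnt0]|cnt0] := count_eventually f0; last first.
  (* With [k] particles left of [m], no window [(-M, 0]] can hold more than [k + absz m]. *)
  exfalso; have near_le : \forall M \near \oo, (absz m <= M)%N by exact: nbhs_infty_ge.
  have [M [[eqM ltM] leM]] := @filter_ex _ _ _ _
    (filterI (filterI cntL (cnt0 (k + absz m)%N)) near_le).
  have := count_sites0_le z m M leM; rewrite !count_sites.
  by rewrite eqM leqNgt ltM.
rewrite (eseries_count R f0 b cnt0).
have [[d cntH]|cntH] := count_eventually fH; last first.
  rewrite (eseries_count_pinfty R fH cntH).
  (* The window event would require exactly [b + n] holes in [(0, M]], which is at most
     [b + absz n]. *)
  apply: filterS (filterI cnt0 (cntH (b + absz n)%N)) => M [eq0 ltH].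
  by split=> [w|[]//]; have [_] := (windowE M).1 w; rewrite eq0; lia.
rewrite (eseries_count R fH d cntH) -EFinB.
have -> : (d%:R - b%:R : R) = (d%:Z - b%:Z)%:~R by rewrite intrB.
apply: filterS (filterI cntL (filterI cnt0 cntH)) => M [eqL [eq0 eqH]].
split=> [w|[_]].
  have [_] := (windowE M).1 w; rewrite eq0 eqH => eqn; split=> //; congr (_%:~R%:E); lia.
move=> -[] /eqP; rewrite eqr_int => /eqP eqn.
by apply/windowE; rewrite eqL eq0 eqH; split=> //; lia.
Qed.

Lemma level_set_eventually (R : realType) (n : int) (z : config) :
  \forall j \near \oo,
    level_set R (- j%:Z) n 0 z <-> [set z | Nfun R z = (n%:~R)%:E] z.
Proof.
pose f0 (j : nat) := z (0 - j%:Z).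
rewrite /level_set /setI /=.
have [[b cnt0]|cnt0] := count_eventually f0; last first.
  (* With infinitely many particles on the left, [Nfun] is -oo, even if its first sum is +oo as
     well, so both sides are false. *)
  exists 0%N => // j _ /=; split=> [[]//|]; rewrite NfunE.
  rewrite (eseries_count_pinfty R f0 cnt0) /=.
  by case: (limn _).
case: cnt0 => r0 _ cnt0; exists r0 => // j /= le_j; split=> [[]//|Nz].
split=> //; rewrite NleftE; apply: eseries_count; exists 0%N => // r _.
apply/eqP; rewrite -leqn0 leqNgt -has_count; apply/hasPn => i _ /=.
(* The count has stabilised before index [j + i], so taking in the site [- (j + i)] does not change
   it and that site is empty. *)
have := countSr f0 (j + i); rewrite !cnt0 /=; first last.
- by lia.
- by lia.
by rewrite /f0 (_ : 0 - (j + i)%N%:Z = - j%:Z - i%:Z); [case: (z _); lia|lia].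
Qed.

(** * Level sets of N *)

Section finite_window.
Context (R : realType) (q : R) (x : int -> R) (mu : probability config R).
Hypothesis q01 : 0 < q < 1.
Hypothesis x_gt0 : forall i, 0 < x i.
Hypothesis xB1 : forall i, x (i - 1) = x i * q.
Hypothesis indep : mutually_independent mu (fun (i : int) (z : config) => z i).
Hypothesis density :
  forall i, mu [set z : config | z i = true] = (x i / (1 + x i))%:E.

Let q_gt0 : 0 < q. Proof. by case/andP: q01. Qed.

Let qpoch_neq0 n : qpoch q q n != 0.
Proof. by rewrite gt_eqF // qpoch_gt0. Qed.

Lemma weight_subn (a : int) (j : nat) : x (a - j%:Z) = x a * q ^+ j.
Proof.
elim: j => [|j IHj]; first by rewrite subr0 mulr1.
have -> : a - j.+1%:Z = a - j%:Z - 1 by lia.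
by rewrite xB1 IHj exprSr mulrA.
Qed.

(* The probability that, in the window (-M, M], all sites up to [n] are empty
   and all sites beyond [n] are occupied. *)
Definition ground_prob (n : int) (M : nat) : R :=
  x M%:Z ^+ absz (M%:Z - n) * q ^+ 'C(absz (M%:Z - n), 2) /
  \prod_(i <- sites M%:Z (M + M)) (1 + x i).

(** q^(kh) times the q-binomial coefficients [M+m, k]_q and [M-m, h]_q, for [k] particles in
    [(-M, m]] and [h] holes in [(m, M]]. *)
Definition window_ratio (m : int) (k h M : nat) : R :=
  q ^+ (k * h) *
    (qpoch q q (absz (M%:Z + m)%R) * qpoch q q (absz (M%:Z - m)%R)) /
  (qpoch q q k * qpoch q q (absz (M%:Z + m)%R - k) *
    (qpoch q q (absz (M%:Z - m)%R - h) * qpoch q q h)).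

Lemma prob_window (m n : int) (k h M : nat) :
  h%:Z = n - m + k%:Z -> (absz m + k + h <= M)%N ->
  fine (mu (window m n k M)) = ground_prob n M * window_ratio m k h M.
Proof.
move=> hE leM.
(* There are [j] holes in [(-M, m]] and [l] particles in [(m, M]]; the lower bound on [M] keeps the
   natural subtractions from truncating. *)
pose j := (absz (M%:Z + m)%R - k)%N; pose l := (absz (M%:Z - m)%R - h)%N.
have rE : absz (M%:Z + m)%R = (k + j)%N by lia.
have sE : absz (M%:Z - m)%R = (l + h)%N by lia.
have nE : absz (M%:Z - n)%R = (l + k)%N by lia.
have catE : sites M%:Z (M + M) = sites M%:Z (l + h) ++ sites m (k + j).
  have -> : (M + M = (l + h) + (k + j))%N by lia.
  by rewrite sites_cat; congr (_ ++ sites _ _); lia.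
have uniq_s : uniq (sites m (k + j) ++ sites M%:Z (l + h)).
  by rewrite uniq_catC -catE uniq_sites.
have windowE : window m n k M =
    count_eq (sites m (k + j)) k `&` count_eq (sites M%:Z (l + h)) l.
  apply/seteqP; split => z; rewrite /window /count_eq /setI /= rE catE count_cat;
    move: (count z (sites m (k + j))) (count z (sites M%:Z (l + h))) => c1 c2;
    by move=> [/eqP-> /eqP ?]; split=> //; apply/eqP; lia.
rewrite windowE (prob_count2 R mu x x_gt0 indep density) //.
rewrite /ground_prob /window_ratio -/j -/l rE sE nE.
have -> : \prod_(i <- sites m (k + j) ++ sites M%:Z (l + h)) (1 + x i) =
    \prod_(i <- sites M%:Z (M + M)) (1 + x i).
  by rewrite catE !big_cat /= mulrC.
set Z := \prod_(i <- _) _.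
have Z_neq0 : Z != 0.
  by rewrite prodf_seq_neq0; apply/allP => i _; rewrite gt_eqF // addr_gt0.
have esymL := esym_sites R q x m k j xB1.
have esymR := esym_sites R q x M%:Z l h xB1.
have {}esymL : esym x (sites m (k + j)) k =
    x m ^+ k * q ^+ 'C(k, 2) * qpoch q q (k + j) / (qpoch q q k * qpoch q q j).
  by rewrite -esymL mulfK // mulf_neq0.
have {}esymR : esym x (sites M%:Z (l + h)) l =
    x M%:Z ^+ l * q ^+ 'C(l, 2) * qpoch q q (l + h) / (qpoch q q l * qpoch q q h).
  by rewrite -esymR mulfK // mulf_neq0.
(* The power [x m ^+ k] contributes q^(k(l+h)). Its part q^(kl) merges the two binomial exponents
   into 'C(l + k, 2), and q^(kh) is left over. *)
have xm : x m = x M%:Z * q ^+ (l + h) by rewrite -weight_subn; congr x; lia.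
have binE : ('C(l + k, 2) = 'C(l, 2) + 'C(k, 2) + l * k)%N.
  elim: (k) => [|k' IHk]; first by rewrite bin0n muln0 !addn0.
  by rewrite addnS !binS !bin1 IHk mulnS; lia.
rewrite esymL esymR xm binE mulnC exprMn -!exprM !exprD !mulnDl !exprD.
rewrite [(k * l)%N]mulnC [(k * h)%N]mulnC; field.
by rewrite Z_neq0 !qpoch_neq0.
Qed.

(** * Passage to the infinite lattice *)

Let cvg_absz_addr (m : int) (u : nat -> R) (a : R) :
  u r @[r --> \oo] --> a -> u (absz (M%:Z + m)%R) @[M --> \oo] --> a.
Proof.
move=> ua; apply/cvgrPdist_lt => e e0.
exact: (near_absz_addr m _ ((cvgrPdist_lt _ _).1 ua e e0)).
Qed.

Let cvg_subn (h : nat) (u : nat -> R) (a : R) :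
  u r @[r --> \oo] --> a -> u (r - h)%N @[r --> \oo] --> a.
Proof.
by move=> ua; rewrite -(cvg_shiftn h); under eq_fun do rewrite addnK.
Qed.

Lemma cvg_window_ratio (m : int) (k h : nat) :
  window_ratio m k h M @[M --> \oo] -->
  q ^+ (k * h) / (qpoch q q k * qpoch q q h).
Proof.
have qinf : qpoch_inf q q != 0 by rewrite gt_eqF // qpoch_inf_gt0.
(* Inserting the square of (q)_oo above and below matches the limit with [window_ratio] factor by
   factor. *)
have -> : q ^+ (k * h) / (qpoch q q k * qpoch q q h) =
    q ^+ (k * h) * (qpoch_inf q q * qpoch_inf q q) /
    (qpoch q q k * qpoch_inf q q * (qpoch_inf q q * qpoch q q h)).
  by field; rewrite qinf !qpoch_neq0.
have cvgq := cvg_qpochqq R q q01.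
apply: cvgM; first apply: cvgMr.
  apply: cvgM; exact: cvg_absz_addr.
apply: cvgV; first by rewrite !mulf_neq0.
apply: cvgM; [apply: cvgMr|apply: cvgMl].
  exact: (cvg_absz_addr m (fun r => qpoch q q (r - k)%N)) (cvg_subn _ _ _ cvgq).
exact: (cvg_absz_addr (- m) (fun r => qpoch q q (r - h)%N)) (cvg_subn _ _ _ cvgq).
Qed.

Let cvg_window m n k : fine (mu (window m n k M)) @[M --> \oo] -->
  fine (mu (level_set R m n k)).
Proof.
apply: cvg_probability_eventually => [M|z]; first exact: measurable_windowE.
exact: window_eventually.
Qed.

Lemma measurable_level_set (m n : int) (k : nat) :
  measurable (level_set R m n k).
Proof.
apply: (measurable_eventually _ _ (window m n k)) => [M|z].
  exact: measurable_windowE.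
exact: window_eventually.
Qed.

(** For [m = n] and [k = h = 0] the ratio is 1, so [ground_prob] is itself a window probability.
    This identifies its limit K(n) as the probability of a level set. *)
Lemma cvg_ground_prob (n : int) :
  ground_prob n M @[M --> \oo] --> fine (mu (level_set R n n 0)).
Proof.
apply: cvg_trans (cvg_window n n 0); apply: near_eq_cvg.
near=> M; rewrite (prob_window n n 0 0); last 2 first.
- by rewrite subrr.
- by rewrite !addn0; near: M; exact: nbhs_infty_ge.
rewrite /window_ratio !subn0 mul0n expr0 qpoch0 mulr1 !mul1r divff ?mulr1 //.
by rewrite mulf_neq0.
Unshelve. all: by end_near. Qed.

Lemma prob_level_set (m n : int) (k h : nat) : h%:Z = n - m + k%:Z ->
  fine (mu (level_set R m n k)) =
  fine (mu (level_set R n n 0)) * (q ^+ (k * h) / (qpoch q q k * qpoch q q h)).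
Proof.
move=> hE; apply: (@cvg_unique _ (@Rhausdorff R) _ _ _ _ (cvg_window m n k)).
apply: cvg_trans (cvgM (cvg_ground_prob n) (cvg_window_ratio m k h)).
apply: near_eq_cvg; near=> M; rewrite /= (prob_window m n k h) //.
by near: M; exact: nbhs_infty_ge.
Unshelve. all: by end_near. Qed.

(* Every configuration with [N = n] is empty far to the left, so no summation
   over [k] is required. *)
Lemma prob_Nfun (n : int) :
  fine (mu [set z | Nfun R z = (n%:~R)%:E]) =
  fine (mu (level_set R n n 0)) / qpoch_inf q q.
Proof.
have cvgN : fine (mu (level_set R (- j%:Z) n 0)) @[j --> \oo] -->
    fine (mu [set z | Nfun R z = (n%:~R)%:E]).
  apply: cvg_probability_eventually => [j|z]; first exact: measurable_level_set.
  exact: level_set_eventually.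
apply: (@cvg_unique _ (@Rhausdorff R) _ _ _ _ cvgN).
have : (fine (mu (level_set R n n 0)) / qpoch q q (absz (j%:Z + n)%R))
    @[j --> \oo] --> fine (mu (level_set R n n 0)) / qpoch_inf q q.
  apply: cvgMr; apply: cvgV; first by rewrite gt_eqF // qpoch_inf_gt0.
  exact: cvg_absz_addr (cvg_qpochqq R q q01).
apply: cvg_trans; apply: near_eq_cvg; near=> j.
have le_nj : (absz n <= j)%N by near: j; exact: nbhs_infty_ge.
(* At [m = - j] and [k = 0] the number of holes is [h = n + j], and the power of q is trivial. *)
rewrite /= (prob_level_set (- j%:Z) n 0 (absz (j%:Z + n)%R)); last by lia.
by rewrite mul0n expr0 qpoch0 !mul1r.
Unshelve. all: by end_near. Qed.

(** * Positivity of K(n) *)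

Lemma prod_sites (a : int) (r : nat) :
  \prod_(i <- sites a r) (1 + x i) = qpoch (- x a) q r.
Proof.
rewrite big_map /qpoch -(big_mkord predT (fun i => 1 - - x a * q ^+ i)).
rewrite /index_iota subn0; apply: eq_bigr => i _.
by rewrite weight_subn mulNr opprK.
Qed.

(** Above [n] the weights grow geometrically, so each factor is written as 1 + x_i = x_i (1 +
    1/x_i). The extracted weights multiply to the power in front, and the inverse weights are
    1/x_(n+1) times powers of q. *)
Lemma prod_sites_top (n : int) (l : nat) :
  \prod_(i <- sites (n + l%:Z) l) (1 + x i) =
  x (n + l%:Z) ^+ l * q ^+ 'C(l, 2) * qpoch (- (x (n + 1))^-1) q l.
Proof.
elim: l => [|l IHl]; first by rewrite big_nil qpoch0 !mulr1.
rewrite sitesS big_cons (_ : n + l.+1%:Z - 1 = n + l%:Z); last lia.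
rewrite IHl qpochS.
have -> : x (n + l%:Z) = x (n + l.+1%:Z) * q by rewrite -xB1; congr x; lia.
have x1 : x (n + 1) = x (n + l.+1%:Z) * q ^+ l.
  by rewrite -weight_subn; congr x; lia.
have -> : 'C(l.+1, 2) = (l + 'C(l, 2))%N by rewrite binS bin1 addnC.
have xl_neq0 : x (n + l.+1%:Z) != 0 by rewrite gt_eqF.
have ql_neq0 : q ^+ l != 0 by rewrite expf_neq0 // gt_eqF.
set p := qpoch _ _ _; rewrite x1 exprMn exprD exprS; field.
by rewrite xl_neq0 ql_neq0.
Qed.

(** Splitting the window at [n] cancels the numerator against the weights extracted by
    [prod_sites_top]. What remains is the inverse of two products that [qpochN_le] bounds uniformly
    in [M]. *)
Lemma ground_prob_ge (n : int) (M : nat) : (absz n <= M)%N ->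
  expR (- (x n / (1 - q) + (x (n + 1))^-1 / (1 - q))) <= ground_prob n M.
Proof.
move=> le_nM; rewrite /ground_prob.
have [l lE] : exists l : nat, l = absz (M%:Z - n)%R by exists (absz (M%:Z - n)%R).
have [j jE] : exists j : nat, j = absz (M%:Z + n)%R by exists (absz (M%:Z + n)%R).
have -> : (M + M = l + j)%N by lia.
have ME : M%:Z = n + l%:Z by lia.
rewrite -lE ME sites_cat (_ : n + l%:Z - l%:Z = n); last lia.
rewrite big_cat /= prod_sites_top prod_sites.
have X_gt0 : 0 < x (n + l%:Z) ^+ l * q ^+ 'C(l, 2) by rewrite mulr_gt0 // exprn_gt0.
set X := _ * q ^+ _ in X_gt0 *.
have pos b r : 0 < b -> 0 < qpoch (- b) q r.
  move=> b0; apply: prodr_gt0 => i _; rewrite mulNr opprK addr_gt0 // mulr_gt0 //.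
  exact: exprn_gt0.
have A_gt0 := pos _ j (x_gt0 n).
have B_gt0 : 0 < qpoch (- (x (n + 1))^-1) q l by apply: pos; rewrite invr_gt0.
rewrite -mulrA invfM mulrA divff ?mul1r ?gt_eqF // invfM expRN expRD.
rewrite -invfM lef_pV2 ?posrE ?mulr_gt0 ?expR_gt0 // mulrC.
apply: ler_pM; [exact: ltW|exact: ltW|exact: qpochN_le (ltW _) _|].
by apply: qpochN_le => //; rewrite invr_ge0 ltW.
Qed.

Lemma ground_level_set_gt0 (n : int) : 0 < fine (mu (level_set R n n 0)).
Proof.
apply: lt_le_trans (expR_gt0 (- (x n / (1 - q) + (x (n + 1))^-1 / (1 - q)))) _.
apply: cvgr_to_ge (cvg_ground_prob n) _.
near=> M; apply: ground_prob_ge; near: M; exact: nbhs_infty_ge.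
Unshelve. all: by end_near. Qed.

End finite_window.

Theorem theorem1p2 (R : realType) (q c : R) (mu : probability config R)
    (n m k : int) :
  0 < q < 1 ->
  is_blocking_measure q c mu ->
  Num.max (m - n) 0 <= k ->
  ergodic_blocking mu n [set z | Nleft R m z = (k%:~R)%:E] =
  q ^ (k * (n - m + k)) * qpoch_inf q q /
    (qpoch q q (absz k) * qpoch q q (absz (n - m + k))).
Proof.
move=> q01 [indep density]; rewrite ge_max => /andP[le_k k_ge0].
have q_gt0 : 0 < q by case/andP: q01.
have q_neq0 : q != 0 by rewrite gt_eqF.
(* The bound [k >= (m - n)^+] says that both [k] and [n - m + k] are nonnegative, so [absz] changes
   neither and the integer power of q is a natural one. *)
have [K kE] : exists K : nat, k = K%:Z by exists (absz k); lia.
have [h hE] : exists h : nat, n - m + k = h%:Z by exists (absz (n - m + k)); lia.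
pose x (i : int) := q `^ (c - i%:~R).
have x_gt0 i : 0 < x i by exact: powR_gt0.
have xB1 i : x (i - 1) = x i * q.
  rewrite /x intrB opprB addrA addrAC [LHS]powRD; last by rewrite q_neq0 implybT.
  by rewrite powRr1 // ltW.
rewrite /ergodic_blocking /cond_prob hE kE -PoszM /= -exprnP.
rewrite -[_ `&` _]/(level_set R m n K).
rewrite (prob_level_set R q x mu q01 x_gt0 xB1 indep density m n K h); last first.
  by rewrite -kE.
rewrite (prob_Nfun R q x mu q01 x_gt0 xB1 indep density).
(* Positivity of K(n) permits cancelling it in the conditional probability. *)
have G_gt0 := ground_level_set_gt0 R q x mu q01 x_gt0 xB1 indep density n.
field; rewrite !gt_eqF ?qpoch_gt0 ?qpoch_inf_gt0 //.
Qed.
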